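(* Let $n$ be any positive integer and let $a_0,b_0,c_0,d_0\in[0,1]$ be any four positive real numbers with $\frac{a_0}{a_0+b_0}\neq\frac{c_0}{c_0+d_0}$. Then there exists a probability distribution of the random vector $(X,A,B_1,\dots,B_n)$ of two-level variables such that $$P(X_1\mid A_1)=\frac{a_0}{a_0+b_0},\qquad P(X_1\mid A_0)=\frac{c_0}{c_0+d_0},$$ and the following holds. (a) If $\frac{a_0}{a_0+b_0}>\frac{c_0}{c_0+d_0}$, then the distribution is an $n$-factor Simpson's Paradox, i.e. for every integer $m$ with $0\le m\le n$ and every $s_m\in S_m$, $$P(X_1\mid A_1\bar B_{s_m})>P(X_1\mid A_0\bar B_{s_m})\ \text{ if } m \text{ is even},\qquad P(X_1\mid A_1\bar B_{s_m})<P(X_1\mid A_0\bar B_{s_m})\ \text{ if } m \text{ is odd}.$$ (b) If $\frac{a_0}{a_0+b_0}<\frac{c_0}{c_0+d_0}$, then for every integer $m$ with $0\le m\le n$ and every $s_m\in S_m$, $$P(X_1\mid A_1\bar B_{s_m})<P(X_1\mid A_0\bar B_{s_m})\ \text{ if } m \text{ is even},\qquad P(X_1\mid A_1\bar B_{s_m})>P(X_1\mid A_0\bar B_{s_m})\ \text{ if } m \text{ is odd}.$$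
   Context: $X$ is a binary random variable with levels $X_1$ (success) and $X_0$ (failure); $A$ is a factor with two levels $A_1$ and $A_0$; each $B_i$ ($1\le i\le n$) is a factor with two levels $B_{i,1}$ and $B_{i,0}$. The level symbols also denote the corresponding events (e.g. $X_1=\{X=1\}$, $A_0=\{A=0\}$, $B_{i,j}=\{B_i=j\}$). For events $C,D$, $CD$ denotes $C\cap D$. For $1\le m\le n$, $S_m=\{0,1\}^m$ is the set of all possible outcomes $s_m=(i_1,\dots,i_m)$ of $(B_1,\dots,B_m)$, and $\bar B_{s_m}=\{B_1=i_1,\dots,B_m=i_m\}$. For $m=0$ there is a single $s_0$, and $\bar B_{s_0}$ is the whole sample space. All conditional probabilities that appear are understood to be well defined, i.e. each conditioning event $A_k\bar B_{s_m}$ has positive probability. An $n$-factor Simpson's Paradox is a probability distribution of $(X,A,B_1,\dots,B_n)$ such that for all $0\le m\le n$ and all $s_m\in S_m$: $P(X_1|A_1\bar B_{s_m})>P(X_1|A_0\bar B_{s_m})$ if $m$ is even, and $P(X_1|A_1\bar B_{s_m})<P(X_1|A_0\bar B_{s_m})$ if $m$ is odd. *)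

(* Defs.v *)
From HB Require Import structures.
From mathcomp Require Import all_boot all_order all_algebra.
From mathcomp Require Import all_classical all_reals all_analysis.

Set Implicit Arguments.
Unset Strict Implicit.
Unset Printing Implicit Defensive.

Import Order.TTheory GRing.Theory Num.Theory.
Local Open Scope classical_set_scope.
Local Open Scope ring_scope.

(* The value space of the random vector (X, A, B_1, ..., B_n). The level 1 is
   encoded by true and the level 0 by false; the factor B_(i+1) is the i-th
   coordinate of the tuple. *)
Notation outcome n := (bool * bool * n.-tuple bool)%type.

Definition X_ {n} (k : bool) : set (outcome n) := [set w | w.1.1 = k].

Definition A_ {n} (k : bool) : set (outcome n) := [set w | w.1.2 = k].

(* For m = 0 this is the whole space. *)
Definition Bbar {n m : nat} (le_mn : (m <= n)%N) (s : m.-tuple bool) :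
    set (outcome n) :=
  [set w | forall i : 'I_m, tnth w.2 (widen_ord le_mn i) = tnth s i].

(* Only meaningful when 0 < P D; otherwise the value is 0. *)
Definition cond_prob {d : measure_display} {T : measurableType d}
    {R : realType} (P : probability T R) (C D : set T) : R :=
  fine (P (C `&` D)) / fine (P D).

Definition cond_defined {R : realType} {n : nat}
    (P : probability (outcome n) R) : Prop :=
  forall (m : nat) (le_mn : (m <= n)%N) (s : m.-tuple bool) (k : bool),
    (0 < P (A_ k `&` Bbar le_mn s))%E.

Definition simpson_paradox {R : realType} {n : nat}
    (P : probability (outcome n) R) : Prop :=
  cond_defined P /\
  forall (m : nat) (le_mn : (m <= n)%N) (s : m.-tuple bool),
    (~~ odd m ->
       cond_prob P (X_ true) (A_ true `&` Bbar le_mn s)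
         > cond_prob P (X_ true) (A_ false `&` Bbar le_mn s)) /\
    (odd m ->
       cond_prob P (X_ true) (A_ true `&` Bbar le_mn s)
         < cond_prob P (X_ true) (A_ false `&` Bbar le_mn s)).

(* Main.v *)
Require Import Defs.
From HB Require Import structures.
From mathcomp Require Import all_boot all_order all_algebra.
From mathcomp Require Import all_classical all_reals all_analysis.
From mathcomp Require Import ring lra zify.

Import Order.TTheory GRing.Theory Num.Theory.
Local Open Scope classical_set_scope.
Local Open Scope ring_scope.

(** The key fact is that any positive two-by-two table of masses for (X, A),
    whichever level of A has the greater success rate in it, is a sum of two
    positive tables in both of which a prescribed level has the greater success
    rate ([split_table]).

    Normalize the given numbers to a table of total mass 1, and split it along
    the infinite binary tree, reversing the prescribed level at each step. Every
    node s, a sequence of levels of B_1, B_2 and so on, then carries a positive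
    table, the tables of the two children of s add up to that of s, and the
    comparison alternates with the depth ([alternating_tables]). Give the outcome
    (x, k, t) of the random vector the (x, k) entry of the table at the leaf t of
    depth n. Because the tables are additive, the masses of the leaves below s
    sum to the table at s ([sum_cylinder]), so that this table consists of the
    probabilities of the events X = x, A = k intersected with the cylinder of s
    ([tree_distribution]). The conditional success rates given that cylinder are
    therefore those of the table at s, whose order is known; at the root they
    are the required ones. *)

(** * Splitting two-by-two tables *)

(** The entry at x and k stands for the mass of the event X = x, A = k. *)
Definition table (R : realType) := bool -> bool -> R.

Definition positive_table {R : realType} (M : table R) :=
  forall x k, 0 < M x k.

(** This is the comparison of success rates, cleared of denominators (see
    [favoursE]): the level k of A succeeds more often than the other level. *)
Definition favours {R : realType} (M : table R) (k : bool) :=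
  M true (~~ k) * M false k < M true k * M false (~~ k).

Lemma favoursE (R : realType) (M : table R) (k : bool) : positive_table M ->
  favours M k <-> M true (~~ k) / (M true (~~ k) + M false (~~ k))
                  < M true k / (M true k + M false k).
Proof.
move=> M_gt0; rewrite ltr_pdivrMr ?addr_gt0// mulrAC ltr_pdivlMr ?addr_gt0//.
by rewrite !mulrDr [X in X + _ < _]mulrC ltrD2l.
Qed.

Lemma small_parameter (R : realType) (u v : R) : 0 < u -> 0 < v ->
  exists e : R, [/\ 0 < e, e <= 1 / 4 & e * u < v / 4].
Proof.
move=> u_gt0 v_gt0; exists (v / (4 * (u + v))).
have uv_gt0 : 0 < 4 * (u + v) by lra.
split; first exact: divr_gt0.
- by rewrite ler_pdivrMr//; lra.
- by rewrite mulrAC ltr_pdivrMr//; nra.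
Qed.

(** The first part takes the fractions 1 - e of the successes and e of the
    failures at the level ~~ k, and e of the successes and e ^ 3 of the failures
    at the level k; the second part is what remains. As e tends to 0, the success
    odds in the first part stay of order at most 1 / e at ~~ k but grow like
    1 / e ^ 2 at k; in the second part they tend to 0 at ~~ k while they keep
    their order of magnitude at k. Hence k is favoured in both parts, whichever
    level M favours. The bound on e in [small_parameter] makes this
    quantitative. *)
Lemma split_table (R : realType) (M : table R) (k : bool) : positive_table M ->
  exists N : bool -> table R,
    [/\ forall b, positive_table (N b), forall b, favours (N b) k
      & forall x j, N true x j + N false x j = M x j].
Proof.
move=> M_gt0.
set u := M true (~~ k) * M false k; set v := M true k * M false (~~ k).
have u_gt0 : 0 < u by exact: mulr_gt0.
have v_gt0 : 0 < v by exact: mulr_gt0.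
have [e [e_gt0 e_le euv]] := small_parameter _ _ _ u_gt0 v_gt0.
pose f (x j : bool) : R :=
  if j == k then (if x then e else e ^+ 3) else (if x then 1 - e else e).
have f01 x j : 0 < f x j < 1.
  have e2 : e ^+ 2 <= 1 by rewrite expr_le1//; lra.
  rewrite /f; case: (j == k); case: x; try by lra.
  by rewrite exprn_gt0//= exprS; nra.
exists (fun b x j => (if b then f x j else 1 - f x j) * M x j); split.
- move=> b x j; apply: mulr_gt0 => //.
  by have := f01 x j; case: b; lra.
- move=> b; rewrite /favours /f !eqxx.
  have -> : (~~ k == k) = false by case: (k).
  case: b.
  + have -> : (1 - e) * M true (~~ k) * (e ^+ 3 * M false k) =
      e ^+ 2 * ((1 - e) * (e * u)) by rewrite /u; ring.
    have -> : e * M true k * (e * M false (~~ k)) = e ^+ 2 * v.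
      by rewrite /v; ring.
    by rewrite ltr_pM2l ?exprn_gt0//; nra.
  + have -> : (1 - (1 - e)) * M true (~~ k) * ((1 - e ^+ 3) * M false k) =
      (1 - e ^+ 3) * (e * u) by rewrite /u; ring.
    have -> : (1 - e) * M true k * ((1 - e) * M false (~~ k)) =
      (1 - e) ^+ 2 * v by rewrite /v; ring.
    (* The inequality follows from e * u < v / 4 and (1 - e) ^ 2 >= 9 / 16. *)
    have e3_ge0 : 0 <= e ^+ 3 by rewrite exprn_ge0// ltW.
    have eu_gt0 : 0 < e * u by exact: mulr_gt0.
    have : (3 / 4) ^+ 2 <= (1 - e) ^+ 2 by rewrite lerXn2r// ?nnegrE; lra.
    by nra.
- by move=> x j; rewrite -mulrDl addrCA subrr addr0 mul1r.
Qed.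

(** * A tree of tables with alternating comparisons *)

(** [split_table] is iterated on the reversed sequence, since a new level is
    appended at the end of s and must be the head for the recursion. Reversing
    the comparison at every step is possible because [split_table] accepts any
    positive table and any prescribed level. *)
Lemma alternating_tables (R : realType) (M : table R) (k : bool) :
    positive_table M -> favours M k ->
  exists W : seq bool -> table R,
    [/\ W [::] = M, forall s, positive_table (W s),
        forall s, favours (W s) (k (+) odd (size s))
      & forall s x j, W (rcons s true) x j + W (rcons s false) x j = W s x j].
Proof.
move=> M_gt0 Mk.
have step (Ml : table R * bool) : exists N : bool -> table R,
    positive_table Ml.1 -> [/\ forall b, positive_table (N b),
      forall b, favours (N b) Ml.2
    & forall x j, N true x j + N false x j = Ml.1 x j].
  have [Ml_gt0|] := pselect (positive_table Ml.1); last by exists (fun=> M).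
  by have [N NP] := split_table _ _ Ml.2 Ml_gt0; exists N.
have [split splitP] := choice step.
pose T := fix T (r : seq bool) : table R :=
  if r is b :: r' then split (T r', k (+) odd (size r)) b else M.
have T_gt0 r : positive_table (T r).
  elim: r => [|b r IHr] //=.
  by have [+ _ _] := splitP (T r, k (+) odd (size (b :: r))) IHr; exact.
exists (T \o rev); split => //.
- by move=> s; exact: T_gt0.
- move=> s; rewrite -size_rev /=; case: (rev s) => [|b r]; first by rewrite addbF.
  by have [_ + _] := splitP (T r, k (+) odd (size (b :: r))) (T_gt0 r); exact.
- move=> s x j; rewrite /= !rev_rcons.
  by have [_ _] := splitP (T (rev s), k (+) odd (size s).+1) (T_gt0 _);
    rewrite /= size_rev.
Qed.

(** Induction on n - size s: a sequence of length n has one extension, itself,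
    and the extensions of a shorter s divide into those of its two children. *)
Lemma sum_cylinder (R : realType) (V : seq bool -> R) (n : nat) (s : seq bool) :
    (forall s, V (rcons s true) + V (rcons s false) = V s) ->
    (size s <= n)%N ->
  \sum_(t : n.-tuple bool | take (size s) t == s) V t = V s.
Proof.
move=> VD; move kE : (n - size s)%N => k; elim: k s kE => [|k IHk] s kE sn.
  have sz : size s == n by lia.
  rewrite (big_pred1 (Tuple sz)) // => t.
  by rewrite /= -val_eqE /= take_oversize// size_tuple; lia.
have ltsn : (size s < n)%N by lia.
rewrite -VD -!IHk ?size_rcons//; try by lia.
have takeS (t : n.-tuple bool) b : (take (size s).+1 t == rcons s b) =
    (take (size s) t == s) && (nth true t (size s) == b).
  by rewrite (take_nth true) ?size_tuple// eqseq_rcons.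
rewrite (bigID (fun t : n.-tuple bool => nth true t (size s))) /=.
congr (_ + _); apply: eq_bigl => t; rewrite takeS ?eqb_id//.
by case: (nth _ _ _).
Qed.

(** * Realizing the tree by a probability distribution *)

Lemma discrete_measure {d : measure_display} {T : measurableType d}
    {R : realType} (r : seq T) (w : T -> R) : (forall x, 0 <= w x) ->
  exists mu : {measure set T -> \bar R},
    forall D, mu D = (\sum_(x <- r | x \in D) w x)%:E.
Proof.
move=> w_ge0; elim: r => [|x r [mu muE]].
  by exists mzero => D; rewrite big_nil.
exists (measure_add (mscale (NngNum (w_ge0 x)) \d_x) mu) => D.
rewrite [LHS]measure_addE muE big_cons /= /mscale /= diracE.
by case: (x \in D); rewrite ?mule1 ?mule0 ?add0e ?EFinD.
Qed.

Lemma discrete_probability {d : measure_display} {T : measurableType d}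
    {R : realType} (r : seq T) (w : T -> R) : (forall x, 0 <= w x) ->
    \sum_(x <- r) w x = 1 ->
  exists P : probability T R, forall D, P D = (\sum_(x <- r | x \in D) w x)%:E.
Proof.
move=> w_ge0 w1; have [mu muE] := discrete_measure r w w_ge0.
have mu1 : mu setT = 1%E.
  by rewrite muE -[in RHS]w1; congr EFin; apply: eq_bigl => x; rewrite in_setT.
(* Normalizing a measure of total mass 1 does not change it, and the result
   carries the structure of a probability. *)
exists (mnormalize mu point) => D.
by rewrite -muE /= /mnormalize mu1 onee_eq0 /= invr1 mule1.
Qed.

Lemma mem_Bbar (n m : nat) (le_mn : (m <= n)%N) (s : m.-tuple bool)
    (x k : bool) (t : n.-tuple bool) :
  ((x, k, t) \in Bbar le_mn s) = (take m t == s).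
Proof.
have sz : size (take m t) = m by rewrite size_takel ?size_tuple.
apply/idP/eqP => [/[!inE] h|h].
  apply: (@eq_from_nth _ true) => [|i]; rewrite sz ?size_tuple// => im.
  have := h (Ordinal im).
  by rewrite !(tnth_nth true) /= nth_take.
rewrite inE => i.
by rewrite !(tnth_nth true) /= -h nth_take.
Qed.

Lemma mem_cell (n m : nat) (le_mn : (m <= n)%N) (s : m.-tuple bool)
    (x k x' k' : bool) (t : n.-tuple bool) :
  ((x', k', t) \in X_ x `&` (A_ k `&` Bbar le_mn s)) =
  [&& x' == x, k' == k & take m t == s].
Proof.
rewrite !in_setI mem_Bbar; congr [&& _, _ & _]; apply/idP/eqP; by rewrite inE.
Qed.

(** The outcome (x, k, t) gets mass W t x k; additivity of W along the tree makes
    the tables at inner nodes the joint masses of X and A on the cylinders. *)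
Lemma tree_distribution (R : realType) (n : nat) (W : seq bool -> table R) :
    (forall s, positive_table (W s)) ->
    (forall s x j, W (rcons s true) x j + W (rcons s false) x j = W s x j) ->
    \sum_x \sum_k W [::] x k = 1 ->
  exists P : probability (outcome n) R,
    forall (m : nat) (le_mn : (m <= n)%N) (s : m.-tuple bool) (k : bool),
      P (A_ k `&` Bbar le_mn s) = (W s true k + W s false k)%:E /\
      P (X_ true `&` (A_ k `&` Bbar le_mn s)) = (W s true k)%:E.
Proof.
move=> W_gt0 WD W1.
pose w (o : outcome n) := W o.2 o.1.1 o.1.2.
pose S (D : set (outcome n)) := \sum_(o | o \in D) w o.
have cellE m (le_mn : (m <= n)%N) (s : m.-tuple bool) x k :
    S (X_ x `&` (A_ k `&` Bbar le_mn s)) = W s x k.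
  rewrite /S (reindex_onto (fun t => (x, k, t)) snd) /=; last first.
    by move=> [[x' k'] t]; rewrite mem_cell => /and3P[/eqP-> /eqP-> _].
  rewrite -(sum_cylinder _ (fun r => W r x k) n) ?size_tuple//.
  by apply: eq_bigl => t; rewrite mem_cell !eqxx andbT.
(* Applied to the coordinate X, then to A, this decomposes the events below into
   cells. *)
have SID (f : outcome n -> bool) D :
    S D = S ([set o | f o = true] `&` D) + S ([set o | f o = false] `&` D).
  have in_fiber o b : (o \in [set o | f o = b]) = (f o == b).
    by apply/idP/eqP; rewrite inE.
  rewrite /S (bigID f) /=; congr (_ + _); apply: eq_bigl => o;
  by rewrite in_setI in_fiber andbC ?eqb_id ?eqbF_neg.
have marginE m (le_mn : (m <= n)%N) (s : m.-tuple bool) k :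
    S (A_ k `&` Bbar le_mn s) = W s true k + W s false k.
  by rewrite (SID (fun o => o.1.1)) !cellE.
have ST : S setT = 1.
  have -> : setT = Bbar (leq0n n) [tuple] by apply/seteqP; split=> // o _ [].
  by rewrite (SID (fun o => o.1.2)) !marginE -W1 !big_bool /= addrACA.
have [|P PE] := discrete_probability (index_enum (outcome n : finType)) w
  (fun o => ltW (W_gt0 _ _ _)).
  by rewrite -[RHS]ST; apply: eq_bigl => o; rewrite in_setT.
by exists P => m le_mn s k; rewrite !PE -marginE -cellE.
Qed.

Theorem mainTheorem1 (R : realType) (n : nat) (n_gt0 : (0 < n)%N)
    (a0 b0 c0 d0 : R)
    (ha : 0 < a0 <= 1) (hb : 0 < b0 <= 1) (hc : 0 < c0 <= 1) (hd : 0 < d0 <= 1)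
    (hne : a0 / (a0 + b0) <> c0 / (c0 + d0)) :
  exists P : probability (outcome n) R,
    cond_defined P /\
    cond_prob P (X_ true) (A_ true) = a0 / (a0 + b0) /\
    cond_prob P (X_ true) (A_ false) = c0 / (c0 + d0) /\
    (a0 / (a0 + b0) > c0 / (c0 + d0) -> simpson_paradox P) /\
    (a0 / (a0 + b0) < c0 / (c0 + d0) ->
       forall (m : nat) (le_mn : (m <= n)%N) (s : m.-tuple bool),
         (~~ odd m ->
            cond_prob P (X_ true) (A_ true `&` Bbar le_mn s)
              < cond_prob P (X_ true) (A_ false `&` Bbar le_mn s)) /\
         (odd m ->
            cond_prob P (X_ true) (A_ true `&` Bbar le_mn s)
              > cond_prob P (X_ true) (A_ false `&` Bbar le_mn s))).
Proof.
move: ha hb hc hd => /andP[a_gt0 _] /andP[b_gt0 _] /andP[c_gt0 _] /andP[d_gt0 _].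
have tot_gt0 : 0 < a0 + b0 + c0 + d0 by lra.
pose M : table R := fun x k =>
  (if k then (if x then a0 else b0) else (if x then c0 else d0))
  / (a0 + b0 + c0 + d0).
have M_gt0 : positive_table M.
  by move=> x k; apply: divr_gt0 => //; case: k; case: x.
have M1 : \sum_x \sum_k M x k = 1.
  by rewrite !big_bool /M /=; field; rewrite gt_eqF.
have rateM k : M true k / (M true k + M false k) =
    if k then a0 / (a0 + b0) else c0 / (c0 + d0).
  rewrite /M; case: k; rewrite -mulrDl -mulf_div divff ?mulr1//;
  by rewrite ?invr_eq0 gt_eqF.
(* The level of A with the greater success rate overall; the two cases of the
   theorem differ only in its value. *)
set k0 := c0 / (c0 + d0) < a0 / (a0 + b0).
have Mk0 : favours M k0.
  apply/favoursE => //; rewrite !rateM /k0.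
  by case: (ltgtP (c0 / (c0 + d0)) (a0 / (a0 + b0))) hne => //= ->.
have [W [W0 W_gt0 WF WD]] := alternating_tables _ _ _ M_gt0 Mk0.
have [|P PE] := tree_distribution _ n _ W_gt0 WD; first by rewrite W0.
have condE m (le_mn : (m <= n)%N) (s : m.-tuple bool) k :
    cond_prob P (X_ true) (A_ k `&` Bbar le_mn s) =
    W s true k / (W s true k + W s false k).
  by have [Am Cm] := PE m le_mn s k; rewrite /cond_prob Am Cm.
have order m (le_mn : (m <= n)%N) (s : m.-tuple bool) :
    let j := k0 (+) odd m in
    cond_prob P (X_ true) (A_ (~~ j) `&` Bbar le_mn s)
      < cond_prob P (X_ true) (A_ j `&` Bbar le_mn s).
  by rewrite /= !condE; apply/favoursE => //; rewrite -{2}(size_tuple s).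
have cond0 k : cond_prob P (X_ true) (A_ k) = M true k / (M true k + M false k).
  rewrite -[A_ k]setIT.
  have -> : setT = Bbar (leq0n n) [tuple] by apply/seteqP; split=> // o _ [].
  by rewrite condE /= W0.
have defP : cond_defined P.
  move=> m le_mn s k; rewrite (PE m le_mn s k).1 lte_fin.
  by apply: addr_gt0; exact: W_gt0.
exists P; split=> //; rewrite !cond0 !rateM; do 2!split=> //; split=> [k0T|k0F].
- split=> // m le_mn s; have := order m le_mn s.
  by rewrite k0T /=; case: (odd m).
- move=> m le_mn s; have := order m le_mn s.
  have -> : k0 = false by rewrite /k0 ltNge (ltW k0F).
  by case: (odd m).
Qed.
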